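(* The full box product $\square_{n<\omega}(\omega_n+1)$ is ultraparacompact (in particular paracompact).
   Context: For each $n<\omega$, $\omega_n+1=\omega_n\cup\{\omega_n\}$ carries the topology in which every point of $\omega_n$ is isolated and the point $\omega_n$ has as a neighbourhood base the sets $A\cup\{\omega_n\}$ where $A$ is a co-bounded subset of $\omega_n$ (so $\omega_0+1$ is the convergent sequence $\omega+1$). The full box product $\square_{n<\omega}Y_n$ is $\prod_{n<\omega}Y_n$ with base all products of open sets. A space is ultraparacompact if every open cover has a refinement (a cover each member of which lies in a member of the given cover) consisting of pairwise disjoint clopen sets. *)

(* Defs.v *)
From HB Require Import structures.
From mathcomp Require Import all_boot all_order.
From mathcomp Require Import all_classical all_analysis.

Set Implicit Arguments.
Unset Strict Implicit.
Unset Printing Implicit Defensive.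

Import Order.TTheory.
Local Open Scope classical_set_scope.
Local Open Scope card_scope.
Local Open Scope order_scope.

Notation nat_display := Order.NatOrder.nat_display.

(* V is a well-order of the least order type that does not inject into W.
   This determines V up to order isomorphism: for infinite W of cardinality k,
   it is the initial ordinal of the successor cardinal of k. *)
Definition is_hartogs (W V : bOrderType nat_display) : Prop :=
  [/\ wochoice.well_order (<=%O : rel V),
      ~ ([set: V] #<= [set: W])
    & forall v : V, [set u : V | u < v] #<= [set: W]].

Section HartogsExists.
Variables (W : bOrderType nat_display) (R : rel (set W)).
Hypothesis woR : wochoice.well_order R.

Let wo_min (P : set (set W)) : P !=set0 ->
  exists2 z, P z & forall y, P y -> R z y.
Proof.
move=> [x Px]; have [|z [[Pz zP] _]] := woR (A := fun y => `[< P y >]).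
  by exists x; apply/asboolP.
by exists z; [exact/asboolP | move=> y Py; apply: zP; apply/asboolP].
Qed.

Let R_total : total R.
Proof.
move=> x y; have [|z [->|->] zP] := @wo_min [set x; y]; first by exists x; left.
  by rewrite zP //; right.
by rewrite orbC zP //; left.
Qed.

Let R_anti : antisymmetric R.
Proof.
move=> x y /andP[xy yx].
have Rxx z : R z z by have := R_total z z; rewrite orbb.
have [|z [_ zU]] := woR (A := fun u => `[< u = x \/ u = y >]).
  by exists x; apply/asboolP; left.
have <- : z = x.
  apply: zU; split; first by apply/asboolP; left.
  by move=> u /asboolP[] ->.
apply: zU; split; first by apply/asboolP; right.
by move=> u /asboolP[] ->.
Qed.

Let R_trans : transitive R.
Proof.
move=> y x z xy yz.
have [|m /= mE mP] := @wo_min [set u | [\/ u = x, u = y | u = z]].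
  by exists x; apply: Or31.
case: mE => mE; subst m.
- by apply: mP; apply: Or33.
- have -> // : x = y by apply: R_anti; rewrite xy mP //; apply: Or31.
- have zx : R z x by apply: mP; apply: Or31.
  have zy : R z y by apply: mP; apply: Or32.
  have yz' : y = z by apply: R_anti; rewrite yz zy.
  by rewrite -yz'.
Qed.

Let below (x : set W) : set (set W) := [set y | R y x /\ y <> x].

Let small (x : set W) : bool := `[< below x #<= [set: W] >].

Let V : Type := {x : set W | small x}.

Let V_le : rel V := fun u v => R (val u) (val v).

HB.instance Definition _ := Choice.on V.

Let V_refl : reflexive V_le.
Proof. by move=> u; have := R_total (val u) (val u); rewrite orbb. Qed.

Let V_anti : antisymmetric V_le.
Proof. by move=> u v uv; apply/val_inj/R_anti. Qed.

Let V_trans : transitive V_le.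
Proof. by move=> v u w; apply: R_trans. Qed.

HB.instance Definition _ :=
  Order.Le_isPOrder.Build nat_display V V_refl V_anti V_trans.

Let V_total : total (<=%O : rel V).
Proof. by move=> u v; apply: R_total. Qed.

HB.instance Definition _ := Order.POrder_isTotal.Build nat_display V V_total.

Let bot_ex : exists b : V, forall u : V, b <= u.
Proof.
have [|z _ zP] := @wo_min setT; first by exists set0.
have sz : small z.
  apply/asboolP; suff -> : below z = set0 by apply: card_ge0.
  apply/seteqP; split => // y [yz]; apply.
  by apply: R_anti; rewrite yz zP.
by exists (exist _ z sz) => u; apply: zP.
Qed.

HB.instance Definition _ :=
  Order.hasBottom.Build nat_display V (projT2 (cid bot_ex)).

Lemma hartogs_of_well_order : exists V, is_hartogs W V.
Proof.
exists V; split.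
- apply: wochoice.antisymmetric_well_order; first exact: le_anti.
  move=> A [x Ax].
  have [|z [u Au uz] zP] := @wo_min [set val u | u in [set u : V | u \in A]].
    by exists (val x), x.
  exists u; split=> // v Av.
  by rewrite /Order.le /= /V_le uz; apply: zP; exists v.
- move=> VW.
  have smallP x : small x.
    apply: contrapT => nx.
    have [|z nz zP] := @wo_min [set y | ~ small y]; first by exists x.
    apply: nz; apply/asboolP; apply: card_le_trans VW.
    have sb y : below z y -> small y.
      move=> [yz nyz]; apply: contrapT => ny; apply: nyz.
      by apply: R_anti; rewrite yz zP.
    have -> : below z = [set val u | u in [set u : V | below z (val u)]].
      apply/seteqP; split => [y yb|y [u ub <-//]].
      by exists (exist _ y (sb y yb)).
    by apply: card_le_trans (card_image_le _ _) _; apply: subset_card_le.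
  have /card_leP[f] : [set: set W] #<= [set: W].
    apply: card_le_trans VW.
    have -> : [set: set W] = [set val u | u in [set: V]].
      by apply/seteqP; split=> // y _; exists (exist _ y (smallP y)).
    exact: card_image_le.
  pose g (A : set W) : W := val (f (to_setT A)).
  have ginj : injective g.
    move=> A B /val_inj /(@inj _ _ _ f).
    by rewrite !in_setT => /(_ isT isT)[].
  pose D := [set w | exists2 A, g A = w & ~ A w].
  have nD : ~ D (g D) by move=> /[dup] DgD [A /ginj ->].
  by apply: (nD); exists D.
- move=> v; have /asboolP := valP v; apply: card_le_trans.
  have vI : {in [set u : V | u < v] &, injective (val : V -> set W)}.
    by move=> ? ? _ _; exact: val_inj.
  rewrite -(card_le_eql (inj_card_eq vI)); apply: subset_card_le.
  move=> _ [u /= uv <-]; split; first exact: ltW uv.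
  by move=> /val_inj uv'; move: uv; rewrite uv' ltxx.
Qed.
End HartogsExists.

Lemma hartogs_exists (W : bOrderType nat_display) : exists V, is_hartogs W V.
Proof.
by have [R woR] := wochoice.well_ordering_principle (set W);
  exact: hartogs_of_well_order woR.
Qed.

Definition hartogs (W : bOrderType nat_display) : bOrderType nat_display :=
  sval (cid (hartogs_exists W)).

(* The initial ordinal of the n-th infinite cardinal; omega 0 is nat. *)
Definition omega (n : nat) : bOrderType nat_display :=
  iter n hartogs (nat : bOrderType nat_display).

Lemma omegaS (n : nat) : is_hartogs (omega n) (omega n.+1).
Proof. by rewrite /omega iterS; exact: svalP (cid _). Qed.

(* The ordinal W + 1, with None as the added last point. *)
Definition order_succ (W : bOrderType nat_display) : Type := option W.

Section OrderSuccTopology.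
Variable W : bOrderType nat_display.

HB.instance Definition _ := Choice.on (order_succ W).

Definition cobounded (A : set W) : Prop := has_ubound (~` A).

Definition order_succ_nbhs (x : order_succ W) : set_system (order_succ W) :=
  if x is Some a then principal_filter (Some a)
  else filter_from cobounded (fun A => (Some @` A) `|` [set None]).

Let order_succ_filter (x : order_succ W) : ProperFilter (order_succ_nbhs x).
Proof.
case: x => [a|]; first exact: principal_filter_proper.
apply: filter_from_proper; last by move=> ? _; exists None; right.
apply: filter_from_filter.
  by exists setT; rewrite /cobounded setCT; exists \bot.
move=> A B [a Aa] [b Bb]; exists (A `&` B).
  exists (Order.max a b) => w; rewrite setCI => -[/Aa|/Bb] wl.
    by rewrite le_max wl.
  by rewrite le_max wl orbT.
move=> _ [[w [Aw Bw] <-]|->]; last by split; right.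
by split; left; exists w.
Qed.

Let order_succ_singleton (x : order_succ W) U : order_succ_nbhs x U -> U x.
Proof. by case: x => [a|[A _]]; [move/principal_filterP | apply; right]. Qed.

Let order_succ_nbhs_nbhs (x : order_succ W) U :
  order_succ_nbhs x U -> order_succ_nbhs x (order_succ_nbhs^~ U).
Proof.
case: x => [a /principal_filterP Ua|[A cA AU]].
  by apply/principal_filterP/principal_filterP.
exists A => // -[w|] wA; last by exists A.
by apply/principal_filterP/AU.
Qed.

HB.instance Definition _ := hasNbhs.Build (order_succ W) order_succ_nbhs.

HB.instance Definition _ := Nbhs_isNbhsTopological.Build (order_succ W)
  order_succ_filter order_succ_singleton order_succ_nbhs_nbhs.

End OrderSuccTopology.

Definition box_product (I : Type) (Y : I -> topologicalType) : Type :=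
  forall i, Y i.

Section BoxTopology.
Variables (I : Type) (Y : I -> topologicalType).

HB.instance Definition _ := gen_eqMixin (box_product Y).
HB.instance Definition _ := gen_choiceMixin (box_product Y).

Definition box_sides : Type := forall i, set (Y i).

HB.instance Definition _ := gen_eqMixin box_sides.
HB.instance Definition _ := gen_choiceMixin box_sides.
HB.instance Definition _ := isPointed.Build box_sides (fun=> set0).

Definition open_sides : set box_sides := [set U | forall i, open (U i)].

Definition box (U : box_sides) : set (box_product Y) :=
  [set f | forall i, U i (f i)].

Let box_cover : \bigcup_(U in open_sides) box U = setT.
Proof.
apply/seteqP; split=> // f _; exists (fun=> setT) => // i; exact: openT.
Qed.

Let box_join (U V : box_sides) f :
  open_sides U -> open_sides V -> box U f -> box V f ->
  exists O, [/\ open_sides O, box O f & box O `<=` box U `&` box V].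
Proof.
move=> oU oV Uf Vf; exists (fun i => U i `&` V i); split.
- by move=> i; apply: openI.
- by move=> i; split.
- by move=> g Og; split=> i; case: (Og i).
Qed.

HB.instance Definition _ :=
  isBaseTopological.Build (box_product Y) box_cover box_join.

End BoxTopology.

Section CoveringProperties.
Variable X : topologicalType.
Implicit Types C D : set (set X).

Definition covers C : Prop := \bigcup_(U in C) U = [set: X].

Definition open_cover C : Prop := C `<=` open /\ covers C.

Definition refinement C D : Prop :=
  covers D /\ forall V, D V -> exists2 U, C U & V `<=` U.

Definition ultraparacompact : Prop := forall C, open_cover C ->
  exists D, [/\ refinement C D, D `<=` clopen & trivIset D id].

Definition locally_finite D : Prop := forall x : X,
  exists2 N, nbhs x N & finite_set [set V | D V /\ V `&` N !=set0].

Definition paracompact : Prop := forall C, open_cover C ->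
  exists D, [/\ refinement C D, D `<=` open & locally_finite D].

End CoveringProperties.

(* Main.v *)
(* For n > 0 countable subsets of omega_n are bounded, so intersecting countably
   many neighbourhoods is harmless in all factors but the countable factor 0,
   which is treated as the compact factor of a tube lemma: every c has a radius
   a such that, whatever the coordinate 0 is, the box of radius a around c lies
   in a member of the cover.
   Given z, start from the centre c with all coordinates at infinity and
   repeatedly replace c_n by z_n whenever n > 0 and z_n lies below the radius of
   c.  The sets of replaced coordinates increase strictly in the subsets of nat,
   so this stops after countably many steps, at a core c of z such that z lies in
   the tube around c.  The radii met on the way are countably many, hence bounded
   for n > 0, so nearby points go through the same steps and have the same core.
   The fibres of the core, cut by finitely many values of coordinate 0, form the
   required partition. *)
Require Import Defs.
From HB Require Import structures.
From mathcomp Require Import all_boot all_order.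
From mathcomp Require Import all_classical all_analysis.

Set Implicit Arguments.
Unset Strict Implicit.
Unset Printing Implicit Defensive.

Import Order.TTheory.
Local Open Scope order_scope.
Local Open Scope card_scope.
Local Open Scope classical_set_scope.

(** * Injections of well-orders, and countable bounds in Hartogs successors *)

Lemma card_leT_inj (T : Type) (U : choiceType) (u : U) (A : set T) :
  A #<= [set: U] <-> exists f : T -> U, set_inj A f.
Proof.
pose pU : pointedType := HB.pack U (isPointed.Build U u).
by split=> [/(@pcard_leTP T pU)/injPex|] // fP; apply/(@pcard_leTP T pU)/injPex.
Qed.

Lemma wo_minimum d (W : orderType d) (P : set W) :
  wochoice.well_order (<=%O : rel W) -> P !=set0 ->
  exists2 x, P x & forall y, P y -> x <= y.
Proof.
move=> woW [x Px]; have [|z [[Pz zP] _]] := woW (fun y => `[< P y >]).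
  by exists x; apply/asboolP.
by exists z; [exact/asboolP | move=> y Py; apply: zP; apply/asboolP].
Qed.

Section WellOrderWithoutMax.
Variable W : bOrderType nat_display.
Hypothesis woW : wochoice.well_order (<=%O : rel W).
Hypothesis nomaxW : forall w : W, exists v, w < v.

(** Least strict upper bounds are distinct because [w < v] forces [s w <= v < s v]. *)
Lemma wo_succ : exists s : W -> W, injective s /\ forall w, w < s w.
Proof.
have /choice[s sP] (w : W) : exists v, w < v /\ forall u, w < u -> v <= u.
  have [|v] := wo_minimum (P := [set v | w < v]) woW; first exact: nomaxW.
  by exists v.
exists s; split=> [w v swv|w]; last by have [] := sP w.
by apply/eqP; case: ltgtP => // /(proj2 (sP _));
  [rewrite swv | rewrite -swv]; rewrite leNgt (proj1 (sP _)).
Qed.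

Lemma wo_option_inj : exists f : option W -> W, injective f.
Proof.
have [s [sI s_gt]] := wo_succ.
exists (fun x => if x is Some w then s w else \bot).
have sn w : s w <> \bot by move=> e; have := s_gt w; rewrite e ltx0.
by move=> [w|] [v|] //; [move=> /sI -> | move=> /sn | move/esym/sn].
Qed.

(* Every point is uniquely s^k l with l not a successor, and only the countably
   many values of k have to absorb the extra factor nat. *)
Lemma wo_nat_prod_inj : exists f : nat * W -> W, injective f.
Proof.
have [s [sI s_gt]] := wo_succ.
pose decomposed w :=
  exists lk : W * nat, ~ range s lk.1 /\ iter lk.2 s lk.1 = w.
have decomp w : decomposed w.
  apply: contrapT => nw.
  have [v nv vP] := wo_minimum woW (ex_intro (fun w => ~ decomposed w) w nw).
  apply: nv; have [[u _ uv]|nrv] := pselect (range s v);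
    last by exists (v, 0%N).
  have [[l k] [/= nl lk]] : decomposed u.
    by apply: contrapT => /vP; rewrite -uv leNgt s_gt.
  by exists (l, k.+1); rewrite /= lk.
have iterI i j l l' : ~ range s l -> ~ range s l' ->
    iter i s l = iter j s l' -> i = j /\ l = l'.
  move=> nl nl'; elim: i j => [|i IH] [|j] //=.
  - by move=> ll; case: nl; exists (iter j s l').
  - by move=> ll; case: nl'; exists (iter i s l).
  - by move=> /sI /IH[-> ->].
have [lk lkP] := choice decomp.
exists (fun x => iter (pickle (x.1, (lk x.2).2)) s (lk x.2).1).
move=> [m w] [m' w'] /= /iterI[||/(pcan_inj pickleK)[-> e2] e1].
- by have [] := lkP w.
- by have [] := lkP w'.
by rewrite -(proj2 (lkP w)) -(proj2 (lkP w')) e1 e2.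
Qed.

Section Hartogs.
Variable V : bOrderType nat_display.
Hypothesis VW : is_hartogs W V.

(** A maximum [v] would leave [V] as the segment below [v] plus one point. The segment injects into
    [W], and [wo_option_inj] absorbs the point. *)
Lemma hartogs_nomax (v : V) : exists u, v < u.
Proof.
have [woV nVW segVW] := VW; apply: contrapT => vmax.
have /(card_leT_inj \bot)[f fI] := segVW v.
have [g gI] := wo_option_inj.
apply/nVW/(card_leT_inj \bot).
exists (fun u => g (if u < v then Some (f u) else None)).
move=> x y _ _ /gI; case: ifP => xv; case: ifP => yv //.
  by case; apply: fI; rewrite inE.
have ltv u : (u < v) = false -> u = v.
  move=> uv; apply/eqP; rewrite eq_le [v <= u]leNgt uv andbT leNgt.
  by apply/negP => vu; apply: vmax; exists u.
by move=> _; rewrite (ltv _ xv) (ltv _ yv).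
Qed.

(** If [v] were unbounded, [V] would be a countable union of segments that inject into [W], so it
    would inject into [nat * W] and hence into [W]. *)
Lemma hartogs_countable_ubound (v : nat -> V) : exists u, forall m, v m <= u.
Proof.
have [_ nVW segVW] := VW; apply: contrapT => vub.
have /choice[m mP] (u : V) : exists m, u < v m.
  apply: contrapT => um; apply: vub; exists u => m.
  by rewrite leNgt; apply/negP => vu; apply: um; exists m.
have /choice[f fI] (u : V) : exists f : V -> W, set_inj [set x | x < u] f.
  exact/(card_leT_inj \bot)/segVW.
have [g gI] := wo_nat_prod_inj.
apply/nVW/(card_leT_inj \bot); exists (fun u => g (m u, f (v (m u)) u)).
move=> x y _ _ /gI[mxy]; rewrite mxy; apply: fI; rewrite inE //=.
by rewrite -mxy.
Qed.

End Hartogs.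
End WellOrderWithoutMax.

Lemma nat_well_order : wochoice.well_order (<=%O : rel nat).
Proof.
apply: wochoice.antisymmetric_well_order; first exact: le_anti.
move=> A [x Ax]; have exA : exists n, A n by exists x.
have [n An nP] := ex_minnP exA.
by exists n; split=> // k /nP.
Qed.

Lemma omega_wo_nomax n : wochoice.well_order (<=%O : rel (omega n)) /\
  forall w : omega n, exists v, w < v.
Proof.
elim: n => [|n [woW nomaxW]].
  by split; [exact: nat_well_order | move=> w; exists w.+1; exact: ltnSn].
split; first by case: (omegaS n).
exact: (hartogs_nomax woW nomaxW (omegaS n)).
Qed.

Lemma omegaS_countable_ubound n (v : nat -> omega n.+1) :
  exists u, forall m, v m <= u.
Proof.
have [woW nomaxW] := omega_wo_nomax n.
exact: (hartogs_countable_ubound woW nomaxW (omegaS n)).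
Qed.

(** * Transfinite iteration of an extensive set operator *)

Section Tower.
Variables (T : Type) (step : set T -> set T).
Hypothesis step_ext : forall A, A `<=` step A.

(* The transfinite iterates of step from the empty set. *)
Inductive tower : set (set T) :=
| tower_step A : tower A -> tower (step A)
| tower_union (D : set (set T)) : D `<=` tower -> tower (\bigcup_(A in D) A).

(** The Bourbaki-Witt argument, in two inductions. The hypothesis makes [A] extremal: a step from a
    stage strictly inside [A] stays inside, so no stage jumps over [A]. *)
Let tower_comparable A :
    (forall C, tower C -> C `<=` A -> C = A \/ step C `<=` A) ->
  forall B, tower B -> B `<=` A \/ step A `<=` B.
Proof.
move=> extA B; elim=> [{}B tB [BA|AB]|D _ IH].
- by have [->|?] := extA B tB BA; [right|left].
- by right; apply: subset_trans AB (@step_ext _).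
- have [[C DC AC]|nD] := pselect (exists2 C, D C & step A `<=` C).
    by right; apply: subset_trans AC _ => x; exists C.
  left; apply: bigcup_sub => C DC; have [//|AC] := IH C DC.
  by case: nD; exists C.
Qed.

(** Discharges the hypothesis of [tower_comparable], which the induction uses only at stages already
    known to be extremal. *)
Let tower_extremal A : tower A ->
  forall C, tower C -> C `<=` A -> C = A \/ step C `<=` A.
Proof.
elim=> [{}A tA IH C tC CA|{A}D tD IH C tC CD].
  have [CA'|AC] := tower_comparable IH tC; last by left; apply/seteqP; split.
  have [->|CA''] := IH _ tC CA'; right => //.
  exact: subset_trans CA'' (@step_ext _).
have [[A DA CA]|nD] := pselect (exists2 A, D A & C `<=` A); last first.
  left; apply/seteqP; split=> //; apply: bigcup_sub => A DA.
  have [CA|AC] := tower_comparable (IH A DA) tC; first by case: nD; exists A.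
  exact: subset_trans (@step_ext _) AC.
have [eCA|CA'] := IH A DA C tC CA; last first.
  by right; apply: subset_trans CA' _ => x; exists A.
have [[B DB CB]|nD] := pselect (exists2 B, D B & step C `<=` B).
  by right; apply: subset_trans CB _ => x; exists B.
left; apply/seteqP; split=> //; apply: bigcup_sub => B DB.
have [] := tower_comparable (IH A DA) (tD B DB); rewrite -eCA // => CB.
by case: nD; exists B.
Qed.

Lemma tower_linear A B : tower A -> tower B -> B `<=` A \/ step A `<=` B.
Proof. by move=> tA; apply/tower_comparable/tower_extremal. Qed.

Definition tower_top : set T := \bigcup_(A in tower) A.

Lemma tower_top_tower : tower tower_top.
Proof. exact: tower_union. Qed.

Lemma sub_tower_top A : tower A -> A `<=` tower_top.
Proof. by move=> tA x; exists A. Qed.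

Lemma step_tower_top : step tower_top = tower_top.
Proof.
apply/seteqP; split; last exact: step_ext.
exact/sub_tower_top/tower_step/tower_top_tower.
Qed.

Definition tower_avoiding (x : T) : set T :=
  \bigcup_(A in [set A | tower A /\ ~ A x]) A.

(* Unless A is the top, a point x added right after A determines A as the
   largest stage that avoids x: a tower over a countable type is countable. *)
Lemma tower_enum A : tower A ->
  A = tower_top \/ exists x, A = tower_avoiding x.
Proof.
move=> tA; have [sA|] := pselect (step A `<=` A).
  left; apply/seteqP; split; first exact: sub_tower_top.
  apply: bigcup_sub => B; elim=> [{}B tB BA|D _ IH]; last exact: bigcup_sub.
  by have [->|] := tower_extremal tA tB BA.
move=> /existsNP[x /not_implyP[sAx nAx]]; right; exists x.
apply/seteqP; split=> [y Ay|]; first by exists A.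
apply: bigcup_sub => B [tB nBx].
by have [//|AB] := tower_linear tA tB; case: nBx; apply: AB.
Qed.

End Tower.

(** Agreement along [s] alone suffices, since the induction along [t] meets only stages already
    shown to be stages of [s]. *)
Lemma eq_tower (T : Type) (s t : set T -> set T) :
  (forall A, tower s A -> s A = t A) -> tower s = tower t.
Proof.
move=> st; apply/seteqP; split=> A; elim=> [{}A tA IH|D _ IH];
  try exact: tower_union.
- by rewrite st //; apply: tower_step.
- by rewrite -st //; apply: tower_step.
Qed.

(** * Box-open sets and partitions into open fibres *)

Lemma open_boxP (I : Type) (Y : I -> topologicalType)
    (U : set (box_product Y)) :
  open U <-> forall x, U x ->
    exists V : box_sides Y, [/\ open_sides V, box V x & box V `<=` U].
Proof.
split=> [[D oD <-] x [V DV Vx]|UP].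
  by exists V; split=> //; [exact: oD | move=> y Vy; exists V].
exists [set V | @open_sides _ Y V /\ box V `<=` U]; first by move=> V [].
apply/seteqP; split=> [x [V [_ VU] Vx]|x Ux]; first exact: VU.
by have [V [oV Vx VU]] := UP x Ux; exists V.
Qed.

(** Open fibres are clopen, the complement of one being the union of the others. *)
Lemma fibres_ultraparacompact (X : topologicalType) :
    (forall C : set (set X), open_cover C ->
      exists L (l : X -> L), (forall x, open (l @^-1` [set l x])) /\
        forall x, exists2 U, C U & l @^-1` [set l x] `<=` U) ->
  ultraparacompact X.
Proof.
move=> XP C /XP[L [l [lo lC]]].
exists (range (fun x => l @^-1` [set l x])); split.
- split=> [|_ [x _ <-]//]; apply/seteqP; split=> // x _.
  by exists (l @^-1` [set l x]) => //; exists x.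
- move=> _ [x _ <-]; split; [exact: lo | rewrite -openC].
  rewrite (_ : ~` _ =
    \bigcup_(y in [set y | l y <> l x]) (l @^-1` [set l y])); last first.
    apply/seteqP; split=> [y lxy|y [z /= zx ->]//]; by exists y.
  by apply: bigcup_open => y _.
- move=> _ _ [x _ <-] [y _ <-] [z [/= <- <-]] //.
Qed.

Lemma ultraparacompact_paracompact (X : topologicalType) :
  ultraparacompact X -> paracompact X.
Proof.
move=> uX C /uX[D [[cD CD] Dclopen Dtriv]]; exists D; split=> //.
  by move=> V /Dclopen[].
move=> x; have [V DV Vx] : (\bigcup_(U in D) U) x by rewrite cD.
exists V; first by apply: open_nbhs_nbhs; split=> //; case: (Dclopen _ DV).
apply: (@sub_finite_set _ _ [set V]); last exact: finite_set1.
by move=> U [DU UV]; apply: Dtriv.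
Qed.

(** * Neighbourhood bases in [W + 1] *)

Section OrderSuccBase.
Variable W : bOrderType nat_display.
Implicit Types (x y : order_succ W) (a b : W).

(** [None] is below no radius, so [capture] can only ever add isolated coordinates. *)
Definition below y a : bool := if y is Some b then b <= a else false.

(** Isolated points take a dummy radius, so that one family of radii describes a box around any
    point. *)
Definition cone x a : set (order_succ W) :=
  [set y | if x is Some _ then y = x else ~~ below y a].

Lemma cone_refl x a : cone x a x.
Proof. by case: x. Qed.

Lemma below_le y a b : a <= b -> below y a -> below y b.
Proof. by case: y => //= c ab ca; apply: le_trans ab. Qed.

Lemma cone_le x a b : a <= b -> cone x b `<=` cone x a.
Proof.
by move=> ab y; case: x => //=; apply: contra; apply: below_le.
Qed.

Lemma nbhs_coneP x (U : set (order_succ W)) :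
  nbhs x U <-> exists a, cone x a `<=` U.
Proof.
case: x => [c|]; split.
- by move=> /principal_filterP Uc; exists \bot => y /= ->.
- by move=> [a aU]; apply/principal_filterP/aU.
- move=> [A [a Aa] AU]; exists a => -[b|] /= ab; apply: AU; last by right.
  by left; exists b => //; apply: contrapT => /Aa; apply/negP.
- move=> [a aU]; exists [set b | ~~ (b <= a)].
    by exists a => b /= /negP; rewrite negbK.
  by move=> _ [[b ba <-]|->]; apply: aU.
Qed.

Lemma open_cone x a : open (cone x a).
Proof.
rewrite openE => y xy; apply/nbhs_coneP; exists a.
case: x xy => [c /= ->|/=]; first by move=> z /= ->.
by case: y => [b ba z /= ->|_ z].
Qed.

End OrderSuccBase.

(** * The tube lemma, the core and the partition *)

Section BoxOfOrderSucc.
Variable W : nat -> bOrderType nat_display.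
Let X := box_product (fun n => order_succ (W n)).
Implicit Types (x y z : X) (a : forall n, W n).

Definition box_cone x a : set X := [set y | forall n, cone (x n) (a n) (y n)].

Lemma open_box_coneP (U : set X) :
  open U <-> forall x, U x -> exists a, box_cone x a `<=` U.
Proof.
rewrite open_boxP; split=> UP x Ux.
  have [V [oV Vx VU]] := UP x Ux.
  have aP n : {a | cone (x n) a `<=` V n}.
    apply/cid/nbhs_coneP; apply: open_nbhs_nbhs.
    by split; [exact: oV | exact: Vx].
  exists (fun n => sval (aP n)) => y xy; apply: VU => n.
  exact: (svalP (aP n)).
have [a aU] := UP x Ux; exists (fun n => cone (x n) (a n)); split=> //.
  by move=> n; apply: open_cone.
by move=> n; apply: cone_refl.
Qed.

Hypothesis ubW : forall n (v : nat -> W n.+1), exists u, forall m, v m <= u.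
Variable e : nat -> order_succ (W 0%N).
Hypothesis e_surj : forall s, exists k, e k = s.

Section Cover.
Variable C : set (set X).
Hypothesis coverC : open_cover C.

(** As in the tube lemma, [a] is uniform in [s], whereas [U] may depend on [s]. *)
Definition tube c a : Prop := forall s : order_succ (W 0%N), exists2 U, C U &
  forall z, cone s (a 0%N) (z 0%N) ->
    (forall n, cone (c n.+1) (a n.+1) (z n.+1)) -> U z.

Lemma exists_tube c : exists a, tube c a.
Proof.
have [openC CT] := coverC.
pose c_ (s : order_succ (W 0%N)) : X :=
  fun n => if n is k.+1 return order_succ (W n) then c k.+1 else s.
have /choice[f fP] s : exists a, exists2 U, C U & box_cone (c_ s) a `<=` U.
  have [U CU Uc] : (\bigcup_(U in C) U) (c_ s) by rewrite CT.
  have [a aU] := (open_box_coneP U).1 (openC U CU) _ Uc.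
  by exists a, U.
have gP n : {u | forall k, f (e k) n.+1 <= u} by apply/cid/ubW.
(* Countably many [s] have a common bound in coordinates [n.+1]. In coordinate 0 only [None] has a
   cone that depends on the radius, so its radius serves every [s]. *)
exists (fun n => if n is k.+1 return W n then sval (gP k) else f None 0%N).
move=> s; have [U CU fU] := fP s; exists U => // z zs zc; apply: fU => -[|n].
  by case: s zs {CU}.
have [k <-] := e_surj s.
exact: cone_le (svalP (gP n) k) _ (zc n).
Qed.

Definition radius c : forall n, W n := sval (cid (exists_tube c)).

Lemma radiusP c : tube c (radius c).
Proof. exact: svalP (cid _). Qed.

Definition restrict z (A : set nat) : X :=
  fun n => if `[< A n >] then z n else None.

(** Coordinate 0 is kept out because [ubW] bounds sequences of radii only in the other
    coordinates. *)
Definition capture z (A : set nat) : set nat :=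
  A `|` [set n | (0 < n)%N /\ below (z n) (radius (restrict z A) n)].

Lemma capture_ext z A : A `<=` capture z A.
Proof. by move=> n; left. Qed.

Definition core z : X := restrict z (tower_top (capture z)).

(** Coordinate 0 never enters the core, so its value is recorded separately; [None] stands for the
    whole tail beyond the radius. *)
Definition label z : X * order_succ (W 0%N) :=
  (core z, if below (z 0%N) (radius (core z) 0%N) then z 0%N else None).

(** The top stage is a fixed point of [capture]: a coordinate still at infinity in the core cannot
    be below the radius. *)
Lemma cone_core z n :
  cone (core z n.+1) (radius (core z) n.+1) (z n.+1).
Proof.
rewrite {1}/core /restrict; case: asboolP => [_|nz]; first exact: cone_refl.
apply/negP => zn; apply: nz.
by rewrite -(step_tower_top (@capture_ext z)); right.
Qed.

Lemma label_fibre_sub z : exists2 U, C U & label @^-1` [set label z] `<=` U.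
Proof.
have [U CU UP] := radiusP (core z) (label z).2.
exists U => // y /= yz; apply: UP => [|n];
  have <- : core y = core z by case: yz.
- by rewrite -yz /=; case: ifPn => // _; exact: cone_refl.
- exact: cone_core.
Qed.

Lemma tower_capture_Some z A n :
  tower (capture z) A -> A n -> exists w, z n = Some w.
Proof.
elim=> [{}A _ IH [/IH//|[_]]|{A}D _ IH [A DA]]; last exact: IH.
by case: (z n) => // w; exists w.
Qed.

(** By [tower_enum] the stages form a sequence: index 0 is the top, index [k.+1] the largest stage
    avoiding [k]. In coordinate 0 only the radius of the core is consulted, by [label]. *)
Lemma tower_radius_ubound z : exists a : forall n, W n,
  a 0%N = radius (core z) 0%N /\ forall A n, tower (capture z) A ->
    radius (restrict z A) n.+1 <= a n.+1.
Proof.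
pose A_ k := if k is k'.+1 then tower_avoiding (capture z) k'
             else tower_top (capture z).
have aP n : {u | forall k, radius (restrict z (A_ k)) n.+1 <= u}.
  exact/cid/ubW.
exists (fun n => if n is k.+1 return W n then sval (aP k)
                 else radius (core z) 0%N).
split=> // A n tA.
have [->|[k ->]] := tower_enum (@capture_ext z) tA.
- exact: (svalP (aP n) 0%N).
- exact: (svalP (aP n) k.+1).
Qed.

(** In the box, [y] agrees with [z] at isolated coordinates, and where [z] is at infinity [y]
    exceeds every radius met. Hence both have the same stages, and the same core. *)
Lemma label_locally_constant z :
  exists a, box_cone z a `<=` label @^-1` [set label z].
Proof.
have [a [a0 aP]] := tower_radius_ubound z; exists a => y zy.
have yz n w : z n = Some w -> y n = z n.
  by move=> zn; have := zy n; rewrite zn.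
have belowE n b : b <= a n -> below (y n) b = below (z n) b.
  move=> ba; case zn : (z n) => [w|]; first by rewrite (yz _ _ zn) zn.
  have := zy n; rewrite zn /=; apply: contraNF; exact: below_le.
have restrictE A : tower (capture z) A -> restrict y A = restrict z A.
  move=> tA; apply: functional_extensionality_dep => n; rewrite /restrict.
  by case: asboolP => // /(tower_capture_Some tA)[w /yz].
have towerE : tower (capture z) = tower (capture y).
  apply: eq_tower => A tA; rewrite /capture restrictE //; congr (_ `|` _).
  by apply/seteqP; split=> -[|n] [] //= _; rewrite belowE ?aP // => ?; split.
have coreE : core y = core z.
  rewrite /core /tower_top -towerE restrictE //.
  exact: tower_top_tower.
rewrite /= /label coreE belowE ?a0 //; case: ifP => // z0; congr pair.
by case E : (z 0%N) z0 => [w|//] _; rewrite (yz _ _ E) E.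
Qed.

End Cover.

Lemma box_order_succ_ultraparacompact : ultraparacompact X.
Proof.
apply: fibres_ultraparacompact => C coverC.
exists (X * order_succ (W 0%N))%type, (label coverC); split=> z; last first.
  exact: label_fibre_sub.
apply/open_box_coneP => y <-.
exact: label_locally_constant.
Qed.

End BoxOfOrderSucc.

Theorem theorem6p1 :
  ultraparacompact (box_product (fun n : nat => order_succ (omega n))) /\
  paracompact (box_product (fun n : nat => order_succ (omega n))).
Proof.
suff uX : ultraparacompact (box_product (fun n => order_succ (omega n))).
  by split=> //; apply: ultraparacompact_paracompact.
(* [omega 0] is [nat], so decoding into [option nat] enumerates factor 0; numbers that code nothing
   are sent to [None]. *)
apply: (@box_order_succ_ultraparacompact omega (@omegaS_countable_ubound)
  (fun k => odflt None (@unpickle (option nat) k))) => s.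
by exists (@pickle (option nat) s); rewrite pickleK.
Qed.
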